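(* Let $X$ be a klt variety and $x\in X$ a point such that for every finite subset $I\subset\mathbf{R}_{\geq 0}$ the following holds: there is a positive integer $\ell$ (depending on $(X,x)$ and $I$) such that for every $\mathbf{R}$-ideal $\mathfrak{a}$ on $X$ with exponents in $I$, there is a divisor $E$ over $X$ that computes $\mathrm{mld}_x(X,\mathfrak{a})$ and such that $k_E\leq\ell$. Then for every fixed DCC set $J\subset\mathbf{R}_{\geq 0}$, the set $$\{\mathrm{mld}_x(X,\mathfrak{a})\mid \mathfrak{a}\text{ is an }\mathbf{R}\text{-ideal on }X\text{ with exponents in }J,\ (X,\mathfrak{a})\text{ is log canonical around }x\}$$ satisfies ACC.
   Context: We work over an algebraically closed field of characteristic $0$. Varieties are reduced and irreducible; points are closed points. A subset of $\mathbf{R}$ satisfies ACC (resp. DCC) if it contains no infinite strictly increasing (resp. decreasing) sequences. A divisor over $X$ is a prime divisor $E$ on a normal variety $Y$ that is proper and birational over $X$; two such divisors are identified if they give the same valuation $\mathrm{ord}_E$ of the function field. The center $c_X(E)$ is the image of $E$ in $X$. For a nonzero coherent ideal $\mathfrak{b}\subseteq\mathcal{O}_X$, $\mathrm{ord}_E(\mathfrak{b})$ is the integer $e\ge 0$ with $\mathfrak{b}\cdot\mathcal{O}_{Y,E}=(t^e)$, $t$ a uniformizer of the DVR $\mathcal{O}_{Y,E}$. An $\mathbf{R}$-ideal on $X$ is a formal product $\mathfrak{a}=\prod_{j=1}^r\mathfrak{a}_j^{\lambda_j}$ with $\mathfrak{a}_j$ nonzero coherent ideals in $\mathcal{O}_X$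 and $\lambda_j\in\mathbf{R}_{\geq 0}$; it has exponents in $I$ if $\lambda_j\in I$ for all $j$. Put $\mathrm{ord}_E(\mathfrak{a})=\sum_j\lambda_j\,\mathrm{ord}_E(\mathfrak{a}_j)$. For $X$ normal and $\mathbf{Q}$-Gorenstein ($K_X$ is $\mathbf{Q}$-Cartier), $k_E$ is the coefficient of $E$ in the discrepancy divisor $K_{Y/X}$, and the log discrepancy is $a_E(X,\mathfrak{a})=k_E+1-\mathrm{ord}_E(\mathfrak{a})$. The pair $(X,\mathfrak{a})$ is log canonical if $a_E(X,\mathfrak{a})\ge 0$ for every divisor $E$ over $X$; it is log canonical around $x$ if this holds after restricting to some open neighborhood of $x$. The variety $X$ is klt if it is normal, $\mathbf{Q}$-Gorenstein, and $k_E+1>0$ for every divisor $E$ over $X$. The minimal log discrepancy is $\mathrm{mld}_x(X,\mathfrak{a})=\inf\{a_E(X,\mathfrak{a})\mid E \text{ a divisor over } X,\ c_X(E)=x\}$. If $\mathrm{mld}_x(X,\mathfrak{a})\ge 0$, a divisor $E$ over $X$ computes $\mathrm{mld}_x(X,\mathfrak{a})$ if $c_X(E)=x$ and $a_E(X,\mathfrak{a})=\mathrm{mld}_x(X,\mathfrak{a})$. If $\mathrm{mld}_x(X,\mathfrak{a})<0$, $E$ computes $\mathrm{mld}_x(X,\mathfrak{a})$ if $c_X(E)=x$ and $a_E(X,\mathfrak{a})<0$. *)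

(* Defs.v *)
From HB Require Import structures.
From mathcomp Require Import all_boot all_order all_algebra.
From mathcomp Require Import all_classical all_reals all_analysis.
Set Implicit Arguments.
Unset Strict Implicit.
Unset Printing Implicit Defensive.
Import Order.TTheory GRing.Theory Num.Theory.

Local Open Scope classical_set_scope.
Local Open Scope ring_scope.

(* Varieties are encoded as Zariski models (Chevalley schemata, EGA I, 8).
   An integral separated scheme X of finite type over k with function field K
   is identified with the set of its local rings O_{X,P}, seen as subrings of K;
   P runs over all scheme-theoretic points, so K itself is the generic point.
   For P, Q in X, the inclusion P `<=` Q means that P lies in the closure of Q.
   A birational morphism Y -> X identifies the function fields; it then maps
   Q in Y to the unique P in X dominated by Q. *)

Section Subrings.
Variables (k : closedFieldType) (K : fieldType) (i : {rmorphism k -> K}).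
Implicit Types (A O P Q V E : set K) (X Y U : set (set K)).

Definition is_subring A : Prop :=
  [/\ A 1, (forall a b, A a -> A b -> A (a - b)) &
           (forall a b, A a -> A b -> A (a * b))].

Definition is_subalgebra A : Prop := is_subring A /\ range i `<=` A.

Definition affine_ring A : Prop :=
  (exists s : seq K, A = smallest is_subalgebra [set` s]) /\
  (forall z, exists a b, [/\ A a, A b, b != 0 & z = a / b]).

Definition is_ideal A (c : set K) : Prop :=
  [/\ c `<=` A, c 0, (forall a b, c a -> c b -> c (a + b)) &
      (forall a b, A a -> c b -> c (a * b))].

Definition prime_ideal A (p : set K) : Prop :=
  [/\ is_ideal A p, ~ p 1 &
      forall a b, A a -> A b -> p (a * b) -> p a \/ p b].

Definition localization A (p : set K) : set K :=
  [set z | exists a b, [/\ A a, A b, ~ p b & z = a / b]].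

Definition Spec A : set (set K) :=
  [set O | exists2 p, prime_ideal A p & O = localization A p].

Definition unit_in O : set K := [set a | [/\ a != 0, O a & O a^-1]].

Definition nonunits O : set K := O `\` unit_in O.

Definition local_ring O : Prop :=
  is_subalgebra O /\
  (forall a b, nonunits O a -> nonunits O b -> nonunits O (a + b)).

Definition dominates Q P : Prop := P `<=` Q /\ nonunits P `<=` nonunits Q.

Definition valuation_ring V : Prop :=
  is_subalgebra V /\ (forall z, z != 0 -> V z \/ V z^-1).

(* The last clause is separatedness. *)
Definition variety X : Prop :=
  (exists (n : nat) (A : 'I_n.+1 -> set K),
     (forall j, affine_ring (A j)) /\ X = \bigcup_j Spec (A j)) /\
  (forall O P Q, local_ring O -> X P -> X Q ->
     dominates O P -> dominates O Q -> P = Q).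

(* The Zariski topology, generated by the domains {Q in X | z \in Q} of the
   rational functions z (on a chart Spec A, D(f) is the domain of 1/f). *)
Definition is_open X U : Prop :=
  U `<=` X /\
  forall P, U P -> exists s : seq K, [set` s] `<=` P /\
    forall Q, X Q -> [set` s] `<=` Q -> U Q.

(* Nonempty open subsets of a variety are varieties, so that the second clause
   only excludes the empty set. *)
Definition open_subvariety X U : Prop := is_open X U /\ variety U.

Definition closed_point X P : Prop :=
  X P /\ forall Q, X Q -> Q `<=` P -> Q = P.

Definition normal X : Prop :=
  forall P, X P -> forall (z : K) (f : {poly K}),
    f \is monic -> (forall j, P f`_j) -> root f z -> P z.

(* A birational morphism Y -> X, proper by the valuative criterion (complete
   over X in the language of models). *)
Definition proper_birational_over X Y : Prop :=
  (forall Q, Y Q -> exists2 P, X P & dominates Q P) /\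
  (forall V P, valuation_ring V -> X P -> dominates V P ->
     exists2 Q, Y Q & dominates V Q).

Definition uniformizer O t : Prop :=
  [/\ t != 0, nonunits O t &
      forall z, z != 0 -> exists (n : int) u, unit_in O u /\ z = t ^ n * u].

Definition dvr O : Prop := is_subalgebra O /\ exists t, uniformizer O t.

Definition codim1_point X E : Prop :=
  [/\ X E, E <> setT &
      forall Q, X Q -> E `<=` Q -> Q = E \/ Q = setT].

(* Prime divisors of a normal variety, given by the local rings at their
   generic points; normality makes these local rings DVRs. *)
Definition prime_divisor X E : Prop := codim1_point X E /\ dvr E.

(* Divisors over X are given by their valuation rings O_{Y,E}, so that divisors
   defining the same valuation are equal. *)
Definition divisor_over X E : Prop :=
  exists Y, [/\ variety Y, normal Y, proper_birational_over X Y &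
                prime_divisor Y E].

(* The generic point of c_X(E); thus c_X(E) is the closed point x if and only
   if [center X E = x]. *)
Definition center X E : set K :=
  xget set0 [set P | X P /\ dominates E P].

(* ord_E on nonzero elements of the function field. *)
Definition ord E (z : K) : int :=
  xget 0 [set n : int | exists t u,
            [/\ uniformizer E t, unit_in E u & z = t ^ n * u]].

Definition extend O (b : set K) : set K := smallest (is_ideal O) b.

(* Coherent ideals are given by their stalks b P, for P in X. *)
Definition coherent_ideal X (b : set K -> set K) : Prop :=
  forall P, X P -> exists A c,
    [/\ affine_ring A, Spec A P, Spec A `<=` X, is_ideal A c &
        forall Q, Spec A Q -> b Q = extend Q c].

Definition nonzero_ideal X (b : set K -> set K) : Prop :=
  exists P z, [/\ X P, b P z & z != 0].

Definition ord_ideal X E (b : set K -> set K) : nat :=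
  xget 0%N [set e : nat | exists2 t, uniformizer E t &
              extend E (b (center X E)) = [set t ^+ e * a | a in E]].

Definition derivation (D : K -> K) : Prop :=
  [/\ (forall a b, D (a + b) = D a + D b),
      (forall a b, D (a * b) = a * D b + b * D a) &
      (forall l, D (i l) = 0)].

End Subrings.

(* Data representing K_X and showing that it is Q-Cartier: a rational top form
   w = dx_0 /\ ... /\ dx_(n-1), with K_X = div(w); the derivations d/dx_j of K;
   an index m; for every P in X, a local equation of m K_X at P. *)
Record canonical_datum (K : fieldType) := CanonicalDatum {
  cdim : nat;
  coordinate : 'I_cdim -> K;
  partial : 'I_cdim -> K -> K;
  cartier_index : nat;
  local_equation : set K -> K }.

Arguments coordinate {K} c j : rename.
Arguments partial {K} c j f : rename.
Arguments local_equation {K} c P : rename.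

Section Discrepancy.
Variables (k : closedFieldType) (K : fieldType) (i : {rmorphism k -> K}).
Implicit Types (d : canonical_datum K) (E P Q : set K) (X : set (set K)).

(* The dx_j form a basis of the Kaehler differentials of K over k, with dual
   basis the d/dx_j; hence cdim d is the transcendence degree of K over k. *)
Definition top_form d : Prop :=
  [/\ forall j, derivation i (partial d j),
      forall j l, partial d j (coordinate d l) = (j == l)%:R &
      forall D, derivation i D ->
        exists c : 'I_(cdim d) -> K,
          forall f, D f = \sum_j c j * partial d j f].

(* df_0 /\ ... /\ df_(n-1) = jacobian d f * w. *)
Definition jacobian d (f : 'I_(cdim d) -> K) : K :=
  \det (\matrix_(j < cdim d, l < cdim d) partial d l (f j)).
Arguments jacobian d f : clear implicits.

(* The order of w along E. The top forms regular at E form the free rank one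
   module over O_E generated by the df_0 /\ ... /\ df_(n-1) with all f_j in O_E,
   so w = t^e * (generator), where - e is the least order of a Jacobian. *)
Definition ord_form d E : int :=
  xget 0 [set e : int |
    (exists f, [/\ forall j, E (f j), jacobian d f != 0 &
                   ord E (jacobian d f) = - e]) /\
    (forall f, (forall j, E (f j)) -> jacobian d f != 0 ->
       - e <= ord E (jacobian d f))].

(* X normal: div(w) is a canonical divisor K_X and m K_X is Cartier. *)
Definition Q_gorenstein d X : Prop :=
  [/\ top_form d, (0 < cartier_index d)%N &
      forall P, X P -> local_equation d P != 0 /\
        exists U, [/\ is_open X U, U P &
          forall Q, U Q -> prime_divisor i X Q ->
            (cartier_index d)%:Z * ord_form d Q = ord Q (local_equation d P)]].

(* k_E: the coefficient of E in K_Y - (1/m) pi^*(m K_X), where K_Y = div(w).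
   It does not depend on the choice of d. *)
Definition k_disc d X E : rat :=
  (ord_form d E)%:~R -
  (ord E (local_equation d (center X E)))%:~R / (cartier_index d)%:R.

Definition klt d X : Prop :=
  [/\ variety i X, normal X, Q_gorenstein d X &
      forall E, divisor_over i X E -> 0 < k_disc d X E + 1].

End Discrepancy.

Arguments jacobian {K} d f.

Record R_ideal (R : realType) (K : fieldType) := RIdeal {
  nfactors : nat;
  factor : 'I_nfactors -> set K -> set K;
  exponent : 'I_nfactors -> R }.

Arguments factor {R K} r j P : rename.
Arguments exponent {R K} r j : rename.

Section MLD.
Variables (R : realType) (k : closedFieldType) (K : fieldType).
Variable i : {rmorphism k -> K}.
Implicit Types (d : canonical_datum K) (E x : set K) (X : set (set K)).
Implicit Types (a : R_ideal R K).

Definition R_ideal_on X a : Prop :=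
  forall j, [/\ coherent_ideal i X (factor a j), nonzero_ideal X (factor a j) &
                0 <= exponent a j].

Definition exponents_in (I : set R) a : Prop := forall j, I (exponent a j).

Definition ord_R_ideal X E a : R :=
  \sum_(j < nfactors a) exponent a j * (ord_ideal X E (factor a j))%:R.

Definition log_disc d X a E : R :=
  ratr (k_disc d X E) + 1 - ord_R_ideal X E a.

Definition log_canonical d X a : Prop :=
  forall E, divisor_over i X E -> 0 <= log_disc d X a E.

(* K_X and a are restricted to U by keeping the same form, local equations and
   stalks. *)
Definition log_canonical_around d X a x : Prop :=
  exists U, [/\ open_subvariety i X U, U x & log_canonical d U a].

Definition mld d X a x : \bar R :=
  ereal_inf [set (log_disc d X a E)%:E | E in
               [set E | divisor_over i X E /\ center X E = x]].

Definition computes_mld d X a x E : Prop :=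
  [/\ divisor_over i X E, center X E = x,
      (0 <= mld d X a x)%E -> (log_disc d X a E)%:E = mld d X a x &
      (mld d X a x < 0)%E -> log_disc d X a E < 0].

End MLD.

Definition ACC (disp : Order.disp_t) (T : porderType disp) (S : set T) : Prop :=
  ~ exists u : nat -> T, forall n, S (u n) /\ (u n < u n.+1)%O.

Definition DCC (disp : Order.disp_t) (T : porderType disp) (S : set T) : Prop :=
  ~ exists u : nat -> T, forall n, S (u n) /\ (u n.+1 < u n)%O.

(* Main.v *)
(* If the values u_n = mld_x(X, a_n) increased strictly, discard the factors of
   the a_n that are trivial at x or have exponent 0.  As J is DCC, the other
   exponents are bounded below, and log canonicity along one fixed divisor with
   center x bounds both them and the number of factors.  So the number r of
   factors may be taken constant, and the exponents l_{n,j} converge, from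
   below by DCC, to limits l_j (subsequences are replaced by a nonprincipal
   ultrafilter).  Apply the hypothesis to I = {l_1, ..., l_r} and the R-ideals
   a'_n obtained from the a_n by raising the exponents to their limits, and let
   E_n compute mld_x(X, a'_n) with bounded k_{E_n}.  Log canonicity of a_n
   bounds the orders of the factors along E_n, so k_{E_n} and these orders are
   constant for most n; hence a_{E_n}(X, a'_n) is a constant c, and
   a_{E_n}(X, a_n) >= 0 tends to c.  Thus c >= 0, so c = mld_x(X, a'_n), and
   c <= u_n <= a_{E_n}(X, a_n) --> c, which is impossible for strictly
   increasing u_n. *)
Require Import Defs.
From HB Require Import structures.
From mathcomp Require Import all_boot all_order all_algebra.
From mathcomp Require Import all_classical all_reals all_analysis.
Set Implicit Arguments.
Unset Strict Implicit.
Unset Printing Implicit Defensive.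
Import Order.TTheory GRing.Theory Num.Theory.
Import numFieldNormedType.Exports.

Local Open Scope classical_set_scope.
Local Open Scope ring_scope.

(** * Nonunits, ideals and localizations of subrings of a field *)

Section Subrings.
Variable K : fieldType.
Implicit Types (A O Q c p : set K) (a b z : K).

Lemma subring0 A : is_subring A -> A 0.
Proof. by case=> A1 AB _; rewrite -(subrr 1); exact: AB. Qed.

Lemma subringN A a : is_subring A -> A a -> A (- a).
Proof.
move=> rA Aa; rewrite -sub0r; case: (rA) => _ AB _; apply: AB => //.
exact: subring0.
Qed.

Lemma subringD A a b : is_subring A -> A a -> A b -> A (a + b).
Proof.
move=> rA Aa Ab; rewrite -[b]opprK; case: (rA) => _ AB _; apply: AB => //.
exact: subringN.
Qed.

Lemma subringM A a b : is_subring A -> A a -> A b -> A (a * b).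
Proof. by case=> _ _; apply. Qed.

Lemma subringX A a n : is_subring A -> A a -> A (a ^+ n).
Proof.
move=> rA Aa; elim: n => [|n IHn]; first by case: rA.
by rewrite exprS; exact: subringM.
Qed.

Lemma is_ideal_subring A : is_subring A -> is_ideal A A.
Proof.
move=> rA; split=> //; first exact: subring0.
- by move=> a b; exact: subringD.
- by move=> a b; exact: subringM.
Qed.

Lemma is_ideal0 A : is_subring A -> is_ideal A [set 0].
Proof.
move=> rA; split=> //.
- by move=> _ ->; exact: subring0.
- by move=> _ _ -> ->; rewrite addr0.
- by move=> a _ _ ->; rewrite mulr0.
Qed.

Lemma extend_subset A c : is_subring A -> c `<=` A -> extend A c `<=` A.
Proof. by move=> rA cA; apply: smallest_sub => //; exact: is_ideal_subring. Qed.

Lemma extend_ideal A c : is_subring A -> c `<=` A -> is_ideal A (extend A c).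
Proof.
move=> rA cA; split; first exact: extend_subset.
- by move=> I [[]].
- by move=> a b ca cb I Ic; have [[_ _ ID _] _] := Ic; apply: ID; [exact: ca|exact: cb].
- by move=> a b Aa cb I Ic; have [[_ _ _ IM] _] := Ic; apply: IM => //; exact: cb.
Qed.

Lemma nonunits_sub A : nonunits A `<=` A. Proof. by move=> ? []. Qed.

Lemma nonunits0 A : is_subring A -> nonunits A 0.
Proof. by move=> rA; split; [exact: subring0|case; rewrite eqxx]. Qed.

Lemma nonunits1 A : ~ nonunits A 1.
Proof. by case=> A1; apply; split; rewrite ?invr1 ?oner_eq0. Qed.

Lemma nonunitsM A a b : is_subring A -> A a -> nonunits A b ->
  nonunits A (a * b).
Proof.
move=> rA Aa [Ab nub]; split; first exact: subringM.
case; rewrite mulf_eq0 negb_or => /andP[a0 b0] _ abV; apply: nub; split=> //.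
suff -> : b^-1 = a * (a * b)^-1 by exact: subringM.
by rewrite invfM mulrA divff // mul1r.
Qed.

Lemma unit_inM A a b : is_subring A -> unit_in A a -> unit_in A b -> unit_in A (a * b).
Proof.
by move=> rA [a0 Aa aV] [b0 Ab bV]; split; rewrite ?mulf_neq0 ?invfM //; exact: subringM.
Qed.

Lemma localization_den A p b : is_ideal A p -> ~ p b -> b != 0.
Proof. by case=> _ p0 _ _ npb; apply/eqP => b0; apply: npb; rewrite b0. Qed.

Lemma sub_localization A p : is_subring A -> prime_ideal A p ->
  A `<=` localization A p.
Proof.
by move=> [A1 _ _] [_ p1 _] a Aa; exists a, 1; split; rewrite ?divr1.
Qed.

Lemma localization_subring A p : is_subring A -> prime_ideal A p ->
  is_subring (localization A p).
Proof.
move=> rA [ip p1 pM]; split.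
- by exists 1, 1; split; rewrite ?divr1 //; case: rA.
- move=> _ _ [a [b [Aa Ab npb ->]]] [c [e [Ac Ae npe ->]]].
  have b0 := localization_den ip npb; have e0 := localization_den ip npe.
  exists (a * e - c * b), (b * e); split.
  + by case: (rA) => _ AB _; apply: AB; exact: subringM.
  + exact: subringM.
  + by case/(pM _ _ Ab Ae).
  + by rewrite -mulNr addf_div // mulNr.
- move=> _ _ [a [b [Aa Ab npb ->]]] [c [e [Ac Ae npe ->]]].
  exists (a * c), (b * e); split; try exact: subringM.
  + by case/(pM _ _ Ab Ae).
  + by rewrite mulf_div.
Qed.

Lemma nonunits_localization A p z : is_subring A -> prime_ideal A p ->
  nonunits (localization A p) z <-> exists a b, [/\ p a, A b, ~ p b & z = a / b].
Proof.
move=> rA pp; have [ip p1 pM] := pp; split.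
- case=> -[a [b [Aa Ab npb ->]]] nu; exists a, b; split=> //.
  apply: contrapT => npa; apply: nu.
  have a0 := localization_den ip npa; have b0 := localization_den ip npb.
  split; first by rewrite mulf_neq0 ?invr_neq0.
  + by exists a, b.
  + by exists b, a; split; rewrite ?invf_div.
- move=> [a [b [pa Ab npb ->]]].
  have [pA p0 _ pMl] := ip.
  have b0 := localization_den ip npb; split; first by exists a, b; split=> //; exact: pA.
  case=> ab0 _ [c [e [Ac Ae npe]]]; rewrite invf_div => /eqP.
  have a0 : a != 0 by apply: contraNneq ab0 => ->; rewrite mul0r.
  have e0 := localization_den ip npe.
  rewrite eqr_div // => /eqP be; have : p (c * a) by exact: pMl.
  by rewrite -be => /(pM _ _ Ab Ae)[].
Qed.

Lemma dominates_trans O Q A : dominates O Q -> dominates Q A -> dominates O A.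
Proof. by move=> [QO nQO] [AQ nAQ]; split; apply: subset_trans; eassumption. Qed.

End Subrings.

(** * Affine charts, contraction of primes, and preimages of open subvarieties *)

Section Models.
Variables (k : closedFieldType) (K : fieldType) (i : {rmorphism k -> K}).
Implicit Types (A B C O P Q E p : set K) (X Y U : set (set K)).

Lemma localization_local A p : is_subalgebra i A -> prime_ideal A p ->
  local_ring i (localization A p).
Proof.
move=> [rA kA] pp; split.
  split; first exact: localization_subring.
  exact: subset_trans (sub_localization rA pp).
move=> z y; rewrite !nonunits_localization //.
move=> [a [b [pa Ab npb ->]]] [c [e [pc Ae npe ->]]].
have [ip p1 pM] := pp; have [_ _ pD pMl] := ip.
exists (a * e + c * b), (b * e); split.
- by apply: pD; rewrite mulrC; exact: pMl.
- exact: subringM.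
- by case/(pM _ _ Ab Ae).
- by rewrite addf_div // (localization_den ip).
Qed.

(** The ideal is the trace on [A] of the maximal ideal of [Q], that is, the image of the closed
    point under Spec Q -> Spec A. *)
Lemma prime_contraction A Q : is_subring A -> local_ring i Q -> A `<=` Q ->
  prime_ideal A (A `&` nonunits Q).
Proof.
move=> rA [[rQ _] nuD] AQ; split.
- split; first by move=> ? [].
  + by split; [exact: subring0|exact: nonunits0].
  + by move=> a b [Aa na] [Ab nb]; split; [exact: subringD|exact: nuD].
  + by move=> a b Aa [Ab nb]; split; [exact: subringM|apply: nonunitsM => //; exact: AQ].
- by case=> _; exact: nonunits1.
- move=> a b Aa Ab [_ nab]; apply: contrapT => /not_orP[na nb].
  have ua c : A c -> ~ (A `&` nonunits Q) c -> unit_in Q c.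
    by move=> Ac nc; apply: contrapT => nu; apply: nc; split=> //; split=> //; exact: AQ.
  by case: nab => _; apply; apply: unit_inM => //; exact: ua.
Qed.

Lemma dominates_contraction A Q : is_subring A -> local_ring i Q ->
  A `<=` Q -> dominates Q (localization A (A `&` nonunits Q)).
Proof.
move=> rA lQ AQ; have pp := prime_contraction rA lQ AQ.
have [[rQ _] nuD] := lQ.
have unQ b : A b -> ~ (A `&` nonunits Q) b -> Q b^-1.
  move=> Ab nb; suff [] : unit_in Q b by [].
  by apply: contrapT => nu; apply: nb; split=> //; split=> //; exact: AQ.
split.
- by move=> _ [a [b [Aa Ab nb ->]]]; apply: subringM => //; [exact: AQ|exact: unQ].
- move=> z /nonunits_localization -/(_ rA pp)[a [b [[Aa na] Ab nb ->]]].
  by rewrite mulrC; apply: nonunitsM => //; exact: unQ.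
Qed.

(** A denominator taken from [A] outside [p] is a unit of [Q]: a nonunit of [Q] would remain a
    nonunit in the localization. *)
Lemma localization_eq A p Q : prime_ideal A p ->
  is_subring A -> is_subring Q -> A `<=` Q ->
  dominates (localization A p) Q -> localization A p = Q.
Proof.
move=> pp rA rQ AQ [QO nQO]; apply/seteqP; split=> // _ [a [b [Aa Ab npb ->]]].
apply: subringM => //; first exact: AQ.
suff [] : unit_in Q b by [].
apply: contrapT => nu; have : nonunits Q b by split=> //; exact: AQ.
move=> /nQO[_]; apply; have b0 := localization_den (let: And3 ip _ _ := pp in ip) npb.
split=> //; first exact: sub_localization.
by exists 1, b; split; rewrite ?div1r //; case: rA.
Qed.

Lemma smallest_subalgebra G : is_subalgebra i (smallest (is_subalgebra i) G).
Proof.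
split; first split.
- by move=> A [[[]]].
- move=> a b Ga Gb A AG; have [[[_ AB _] _] _] := AG.
  by apply: AB; [exact: Ga|exact: Gb].
- move=> a b Ga Gb A AG; have [[[_ _ AM] _] _] := AG.
  by apply: AM; [exact: Ga|exact: Gb].
- by move=> z kz A [[_ kA] _]; exact: kA.
Qed.

Lemma affine_subalgebra A : affine_ring i A -> is_subalgebra i A.
Proof. by move=> [[s ->] _]; exact: smallest_subalgebra. Qed.

Lemma affine_subring A : affine_ring i A -> is_subring A.
Proof. by move=> /affine_subalgebra[]. Qed.

Lemma Spec_local A Q : affine_ring i A -> Spec A Q -> local_ring i Q.
Proof. by move=> /affine_subalgebra aA [p pp ->]; exact: localization_local. Qed.

Lemma Spec_sub A Q : affine_ring i A -> Spec A Q -> A `<=` Q.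
Proof. by move=> /affine_subring aA [p pp ->]; exact: sub_localization. Qed.

Lemma Spec_generic A : affine_ring i A -> Spec A setT.
Proof.
move=> aA; have rA := affine_subring aA; exists [set 0].
  split; first exact: is_ideal0.
  - by move/eqP; rewrite oner_eq0.
  - by move=> a b _ _ /eqP; rewrite mulf_eq0 => /orP[]/eqP; [left|right].
apply/seteqP; split=> // z _; case: aA => _ /(_ z)[a [b [Aa Ab b0 ->]]].
by exists a, b; split=> //; apply/eqP.
Qed.

Lemma variety_local X P : variety i X -> X P -> local_ring i P.
Proof. by move=> [[n [A [aA ->]]] _] [j _]; exact: Spec_local. Qed.

(** [C] is the compositum A[B], generated by the concatenated generators. These rings serve as
    charts of preimages. *)
Lemma affine_join A B : affine_ring i A -> affine_ring i B ->
  exists C, [/\ affine_ring i C, A `<=` C, B `<=` C &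
    forall Q, local_ring i Q -> A `<=` Q -> B `<=` Q -> C `<=` Q].
Proof.
move=> [[s ->] fA] [[t ->] _]; exists (smallest (is_subalgebra i) [set` s ++ t]).
have AC : smallest (is_subalgebra i) [set` s] `<=`
    smallest (is_subalgebra i) [set` s ++ t].
  apply: sub_smallest2r; first exact: smallest_subalgebra.
  by move=> z /= zs; rewrite mem_cat zs.
have BC : smallest (is_subalgebra i) [set` t] `<=`
    smallest (is_subalgebra i) [set` s ++ t].
  apply: sub_smallest2r; first exact: smallest_subalgebra.
  by move=> z /= zs; rewrite mem_cat zs orbT.
split=> //.
- split; first by exists (s ++ t).
  by move=> z; have [a [b [Aa Ab b0 zE]]] := fA z; exists a, b; split=> //; exact: AC.
- move=> Q [sQ _] sAQ tQ; apply: smallest_sub => // z /=; rewrite mem_cat.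
  by case/orP => zs; [apply: sAQ|apply: tQ]; exact: sub_gen_smallest.
Qed.

(* On charts, {Q in Spec A | Q dominates a point of Spec B} is Spec A[B]. *)
Lemma variety_preimage X Y U : variety i X -> variety i Y -> variety i U ->
  U `<=` X -> proper_birational_over i X Y ->
  variety i [set Q | Y Q /\ exists2 P, U P & dominates Q P].
Proof.
move=> vX vY vU UX [YX _]; have [_ sepX] := vX.
have [[n [A [aA YE]]] sepY] := vY; have [[m [B [aB UE]]] _] := vU.
split; last by move=> O P Q lO [YP _] [YQ _]; exact: sepY.
have /choice[C hC] : forall jl : 'I_n.+1 * 'I_m.+1, exists C,
    [/\ affine_ring i C, A jl.1 `<=` C, B jl.2 `<=` C &
    forall Q, local_ring i Q -> A jl.1 `<=` Q -> B jl.2 `<=` Q -> C `<=` Q].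
  by move=> jl; exact: affine_join.
(* [variety] indexes its charts by an ordinal of successor form, so the pairs of charts are
   renumbered. *)
have cardE : #|{: 'I_n.+1 * 'I_m.+1}| = (n.+1 * m.+1).-1.+1.
  by rewrite card_prod !card_ord.
exists (n.+1 * m.+1).-1, (fun t => C (enum_val (cast_ord (esym cardE) t))).
split; first by move=> t; case: (hC (enum_val (cast_ord (esym cardE) t))).
apply/seteqP; split.
- move=> Q [YQ [P UP dQP]].
  have lQ := variety_local vY YQ.
  move: YQ UP; rewrite YE UE => -[j _ SQ] [l _ SP].
  exists (cast_ord cardE (enum_rank (j, l))) => //.
  rewrite cast_ordK enum_rankK; have [aC AC BC CQ] := hC (j, l).
  have rC := affine_subring aC; have [[rQ _] _] := lQ.
  have {}CQ : C (j, l) `<=` Q.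
    apply: CQ => //; first exact: Spec_sub SQ.
    by apply: subset_trans (proj1 dQP); exact: Spec_sub SP.
  exists (C (j, l) `&` nonunits Q); first exact: prime_contraction.
  apply/seteqP; split; last by case: (dominates_contraction rC lQ CQ).
  (* A denominator over [A j] is a unit of [Q], hence it stays outside the contracted prime of the
     larger ring [C (j, l)]. *)
  case: SQ => q pq QE z; rewrite {1}QE => -[a [b [Aa Ab nqb ->]]].
  exists a, b; split; try exact: AC.
  + move=> [_ [_]]; apply; have b0 := localization_den (let: And3 ip _ _ := pq in ip) nqb.
    split=> //; first by apply: CQ; exact: AC.
    rewrite QE; exists 1, b; split; rewrite ?div1r //.
    by case: (affine_subring (aA j)).
  + by [].
(* Conversely, a point [O] of Spec A[B] dominates some [Q] in [Y] and some [P] in [U]. Separatedness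
   of [X] makes [P] the image of [Q], so [Q] contains A[B] and equals [O]. *)
- move=> O [t _ /=]; case: (enum_val _) => j l SO.
  have [aC AC BC CQ] := hC (j, l).
  have rC := affine_subring aC.
  have lO := Spec_local aC SO; have CO := Spec_sub aC SO.
  have rA := affine_subring (aA j); have rB := affine_subring (aB l).
  have AO : A j `<=` O by exact: subset_trans CO.
  have BO : B l `<=` O by exact: subset_trans CO.
  have dOQ := dominates_contraction rA lO AO.
  have dOP := dominates_contraction rB lO BO.
  set Q := localization (A j) _ in dOQ; set P := localization (B l) _ in dOP.
  have SQ : Spec (A j) Q by exists (A j `&` nonunits O) => //; exact: prime_contraction.
  have SP : Spec (B l) P by exists (B l `&` nonunits O) => //; exact: prime_contraction.
  have YQ : Y Q by rewrite YE; exists j.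
  have UP : U P by rewrite UE; exists l.
  have [P' XP' dQP'] := YX _ YQ.
  have PP' : P' = P.
    by apply: (sepX O) => //; [exact: UX|exact: dominates_trans dQP'].
  rewrite PP' in dQP'.
  have lQ := variety_local vY YQ; have [[rQ _] _] := lQ.
  have {}CQ : C (j, l) `<=` Q.
    apply: CQ => //; first exact: Spec_sub SQ.
    by apply: subset_trans (proj1 dQP'); exact: Spec_sub SP.
  suff -> : O = Q by split=> //; exists P.
  case: SO dOQ => p pp -> dOQ; exact: localization_eq.
Qed.

End Models.

(** * Discrete valuation rings, centers, and orders of coherent ideals *)

Section Divisors.
Variables (k : closedFieldType) (K : fieldType) (i : {rmorphism k -> K}).
Implicit Types (A B C O P Q E p : set K) (X Y U : set (set K)).
Implicit Types (b : set K -> set K) (a t u z : K).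

(** A negative exponent -(n+1) would put t^-1 = z u^-1 t^n into [E] and make [t] a unit. *)
Lemma uniformizer_decomposition E t z : is_subring E -> uniformizer E t ->
  E z -> z != 0 -> exists (n : nat) u, unit_in E u /\ z = t ^+ n * u.
Proof.
move=> rE [t0 [Et nut] dec] Ez z0.
have [n [u [uu zE]]] := dec z z0; case: n zE => n zE; first by exists n, u.
case: nut; split=> //; have [u0 Eu EuV] := uu.
suff -> : t^-1 = z * u^-1 * t ^+ n by apply: subringM; [|exact: subringM|exact: subringX].
by rewrite zE mulfK // -[t ^ _]/(t ^- n.+1) exprS invfM -mulrA mulVf ?mulr1 // expf_neq0.
Qed.

Lemma nonunits_uniformizer E t z : is_subring E -> uniformizer E t ->
  nonunits E z <-> exists2 y, E y & z = t * y.
Proof.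
move=> rE ut; have [t0 nt _] := ut; split.
- move=> [Ez nuz]; have [->|z0] := eqVneq z 0.
    by exists 0; rewrite ?mulr0 //; exact: subring0.
  have [[|n] [u [uu zE]]] := uniformizer_decomposition rE ut Ez z0.
    by case: nuz; rewrite zE expr0 mul1r.
  exists (t ^+ n * u); last by rewrite mulrA -exprS.
  have [Et _] := nt; have [_ Eu _] := uu.
  by apply: subringM => //; exact: subringX.
- by move=> [y Ey ->]; rewrite mulrC; exact: nonunitsM.
Qed.

Lemma dvr_local E : dvr i E -> local_ring i E.
Proof.
move=> [sE [t ut]]; have [rE _] := sE; split=> // a c.
move=> /(nonunits_uniformizer _ rE ut)[a' Ea' ->].
move=> /(nonunits_uniformizer _ rE ut)[c' Ec' ->].
rewrite -mulrDr; apply/(nonunits_uniformizer _ rE ut).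
by exists (a' + c') => //; exact: subringD.
Qed.

(** Of two nonzero nonunits one divides the other, so their sum is a multiple of a nonunit. *)
Lemma valuation_ring_local V : valuation_ring i V -> local_ring i V.
Proof.
move=> [sV VV]; have [rV _] := sV; split=> //.
have half a c : nonunits V a -> nonunits V c -> c != 0 -> V (a / c) -> nonunits V (a + c).
  move=> na nc c0 Vac; rewrite -[a](divfK c0) -[X in _ + X]mul1r -mulrDl.
  by apply: nonunitsM => //; apply: subringD => //; case: rV.
move=> a c na nc; have [->|c0] := eqVneq c 0; first by rewrite addr0.
have [->|a0] := eqVneq a 0; first by rewrite add0r.
case: (VV (a / c)); [by rewrite mulf_neq0 ?invr_neq0|exact: half|].
by rewrite invf_div addrC; exact: half.
Qed.

(** The least power of a uniformizer lying in [c] generates it. *)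
Lemma dvr_ideal E c : dvr i E -> is_ideal E c -> (exists2 z, c z & z != 0) ->
  exists (e : nat) t, uniformizer E t /\ c = [set t ^+ e * a | a in E].
Proof.
move=> [[rE _] [t ut]] [cE c0 cD cM] [z cz z0].
have [t0 [Et _] _] := ut.
have pow y : c y -> y != 0 -> exists (n : nat) u,
    [/\ unit_in E u, y = t ^+ n * u & `[< c (t ^+ n) >]].
  move=> cy y0; have [n [u [uu yE]]] := uniformizer_decomposition rE ut (cE _ cy) y0.
  exists n, u; split=> //; apply/asboolP; have [u0 _ EuV] := uu.
  suff -> : t ^+ n = u^-1 * y by exact: cM.
  by rewrite yE mulrC mulfK.
have exn : exists n, `[< c (t ^+ n) >] by have [n [u []]] := pow z cz z0; exists n.
case: (ex_minnP exn) => e /asboolP ce emin; exists e, t; split=> //.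
apply/seteqP; split=> y.
- move=> cy; have [->|y0] := eqVneq y 0.
    by exists 0; rewrite ?mulr0 //; exact: subring0.
  have [n [u [[_ Eu _] -> /emin en]]] := pow y cy y0.
  exists (t ^+ (n - e) * u); first by apply: subringM => //; exact: subringX.
  by rewrite mulrA -exprD subnKC.
- by move=> [a Ea <-]; rewrite mulrC; exact: cM.
Qed.

Lemma divisor_dvr X E : divisor_over i X E -> dvr i E.
Proof. by move=> [Y [_ _ _ []]]. Qed.

Lemma divisor_dominates X E : divisor_over i X E -> exists2 P, X P & dominates E P.
Proof. by move=> [Y [_ _ [dom _] [[YE _ _] _]]]; exact: dom. Qed.

Lemma centerP X E : divisor_over i X E ->
  X (Defs.center X E) /\ dominates E (Defs.center X E).
Proof.
move=> /divisor_dominates[P XP dP].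
apply: (@xgetPex _ set0 [set P | X P /\ dominates E P]); by exists P.
Qed.

Lemma center_eq X E P : variety i X -> dvr i E -> X P -> dominates E P ->
  Defs.center X E = P.
Proof.
move=> [_ sepX] /dvr_local lE XP dP.
have [XC dC] : [set P | X P /\ dominates E P] (Defs.center X E).
  by apply: xgetPex; exists P.
exact: (sepX E).
Qed.

(** The model of [X] carrying [E] is restricted to the preimage of [U], which still contains [E]
    because the center lies in [U]. *)
Lemma divisor_over_open X U E x : variety i X -> open_subvariety i X U ->
  U x -> divisor_over i X E -> Defs.center X E = x ->
  divisor_over i U E /\ Defs.center U E = x.
Proof.
move=> vX [[UX _] vU] Ux dE cE; have [XC dC] := centerP dE.
rewrite cE in XC dC; split; last exact: center_eq (divisor_dvr dE) Ux dC.
case: (dE) => Y [vY nY pY [[YE ET Emax] dvrE]].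
have [_ sepX] := vX; have [pY1 pY2] := pY.
exists [set Q | Y Q /\ exists2 P, U P & dominates Q P]; split.
- exact: (variety_preimage vX vY vU).
- by move=> Q [YQ _]; exact: nY.
- split; first by move=> Q [].
  (* The point of [Y] supplied by properness over [X] lies over [P] itself, by separatedness, hence
     in the preimage of [U]. *)
  move=> V P vV UP dVP; have [Q YQ dVQ] := pY2 V P vV (UX _ UP) dVP.
  exists Q => //; split=> //; have [P' XP' dQP'] := pY1 Q YQ.
  exists P => //; suff <- : P' = P by [].
  apply: (sepX V) => //; last exact: dominates_trans dQP'.
    exact: valuation_ring_local.
  exact: UX.
- split=> //; split=> //; first by split=> //; exists x.
  by move=> Q [YQ _]; exact: Emax.
Qed.

(** Stalks at different points are compared through the generic stalk: [setT] lies on every chart,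
    and nonzero elements stay nonzero there. *)
Lemma coherent_nonzero X b P : coherent_ideal i X b -> nonzero_ideal X b ->
  X P -> is_subring P -> b P `<=` P /\ exists2 z, b P z & z != 0.
Proof.
move=> cb [P0 [z0 [XP0 bz0 z00]]] XP rP.
have stalk Q : X Q -> is_subring Q -> exists A c, [/\ affine_ring i A, A `<=` Q,
    is_ideal A c, b Q = extend Q c & b setT = extend setT c].
  move=> XQ rQ; have [A [c [aA SQ _ ic bE]]] := cb Q XQ.
  exists A, c; split=> //; last by apply: bE; exact: (Spec_generic aA).
  - exact: Spec_sub aA SQ.
  - exact: bE.
have nz Q c : is_subring Q -> (exists2 z, extend Q c z & z != 0) ->
    exists2 z, c z & z != 0.
  move=> rQ [z cz zN0]; apply: contrapT => nc; move/eqP: zN0; apply.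
  apply: (cz [set 0]); split; first exact: is_ideal0.
  by move=> y cy; apply/eqP/negPn/negP => y0; apply: nc; exists y.
have rT : is_subring (@setT K) by [].
have rP0 : is_subring P0.
  have [A [c [aA SP0 _ _ _]]] := cb P0 XP0.
  by have [[]] := Spec_local aA SP0.
have [A0 [c0 [_ _ _ bP0 bT]]] := stalk P0 XP0 rP0.
have [A [c [_ AP [cA _ _ _] bP bT']]] := stalk P XP rP.
have [y c0y y0] : exists2 z, c0 z & z != 0.
  by apply: (nz P0) => //; exists z0; rewrite -?bP0.
have [w cw w0] : exists2 z, c z & z != 0.
  by apply: (nz setT) => //; exists y => //; rewrite -bT' bT => I [_]; apply.
rewrite bP; split; first by apply: extend_subset => //; exact: subset_trans AP.
by exists w => // I [_]; apply.
Qed.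

(** The extended ideal is a nonzero ideal of a DVR, hence a power of its maximal ideal; thus [xget]
    does not fall back on its default. *)
Lemma ord_idealP X E b : variety i X -> divisor_over i X E ->
  coherent_ideal i X b -> nonzero_ideal X b ->
  exists2 t, uniformizer E t &
    extend E (b (Defs.center X E)) = [set t ^+ ord_ideal X E b * a | a in E].
Proof.
move=> vX dE cb nb; have [XC [CE _]] := centerP dE.
have dvrE := divisor_dvr dE; have [[rE _] _] := dvrE.
have [[rC _] _] := variety_local vX XC.
have [bC [z bz z0]] := coherent_nonzero cb nb XC rC.
have bE : b (Defs.center X E) `<=` E by exact: subset_trans CE.
have ib := extend_ideal rE bE.
apply: (@xgetPex _ 0%N [set e : nat | exists2 t, uniformizer E t &
              extend E (b (Defs.center X E)) = [set t ^+ e * a | a in E]]).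
have [|e [t [ut eq]]] := dvr_ideal dvrE ib; last by exists e, t.
by exists z => // I [_]; apply.
Qed.

(* Both orders vanish exactly when the stalk at the center is the unit ideal. *)
Lemma ord_ideal_eq0 X E E' b : variety i X ->
  divisor_over i X E -> divisor_over i X E' -> Defs.center X E' = Defs.center X E ->
  coherent_ideal i X b -> nonzero_ideal X b ->
  ord_ideal X E b = 0%N -> ord_ideal X E' b = 0%N.
Proof.
move=> vX dE dE' cEE' cb nb; have [t ut] := ord_idealP vX dE cb nb.
move=> /[swap] -> bE.
have [t' ut' bE'] := ord_idealP vX dE' cb nb; rewrite cEE' in bE'.
have lE := dvr_local (divisor_dvr dE); have [[rE _] nuD] := lE.
have [[rE' _] _] := dvr_local (divisor_dvr dE').
have [XC [CE nCE]] := centerP dE; have [_ [CE' _]] := centerP dE'.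
rewrite cEE' in CE'.
have [[rC _] _] := variety_local vX XC.
have [bC _] := coherent_nonzero cb nb XC rC.
(* Otherwise domination would place the whole stalk, and so its extension, inside the maximal ideal
   of [E], although that extension contains 1. *)
have [y by_ uy] : exists2 y, b (Defs.center X E) y & unit_in (Defs.center X E) y.
  apply: contrapT => nuy; apply: (@nonunits1 _ E).
  have bnu : b (Defs.center X E) `<=` nonunits E.
    move=> y by_; apply: nCE; split; first exact: bC.
    by move=> uy; apply: nuy; exists y.
  have : extend E (b (Defs.center X E)) 1.
    by rewrite bE; exists 1; rewrite ?expr0 ?mul1r //; case: rE.
  apply; split=> //; split; [exact: nonunits_sub|exact: nonunits0|by []|].
  by move=> u v Eu nv; exact: nonunitsM.
have [y0 Cy CyV] := uy.
have : extend E' (b (Defs.center X E)) 1.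
  move=> I [[_ _ _ IM] bI]; rewrite -(mulVf y0); apply: IM; first exact: CE'.
  exact: bI.
rewrite bE' => -[z E'z]; case: (ord_ideal X E' b) => // n.
rewrite exprS -mulrA => eq1; exfalso; apply: (@nonunits1 _ E'); rewrite -eq1.
have [_ [E't nut] _] := ut'; rewrite mulrC; apply: nonunitsM => //.
by apply: subringM => //; exact: subringX.
Qed.

End Divisors.

(** * Consequences of DCC for totally ordered sets *)

Lemma DCC_min (disp : Order.disp_t) (T : orderType disp) (J S : set T) :
  DCC J -> S `<=` J -> S !=set0 -> exists2 m, S m & forall s, S s -> (m <= s)%O.
Proof.
move=> dccJ SJ [s0 Ss0]; apply: contrapT => nm; apply: dccJ.
have /choice[g gP] : forall s, exists s', S s -> S s' /\ (s' < s)%O.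
  move=> s; apply: contrapT => ng; apply: nm; exists s.
    by apply: contrapT => nSs; apply: ng; exists s.
  move=> s' Ss'; rewrite leNgt; apply/negP => lts; apply: ng.
  by exists s' => _.
have Sg n : S (iter n g s0) by elim: n => //= n /gP[].
by exists (fun n => iter n g s0) => n; split; [exact/SJ/Sg|have [] := gP _ (Sg n)].
Qed.

Lemma DCC_pos_lbound (R : realType) (J : set R) : DCC J ->
  exists2 e : R, 0 < e & forall r, J r -> 0 < r -> e <= r.
Proof.
move=> dccJ; pose S := J `&` [set r | 0 < r].
have [[s Ss]|S0] := pselect (S !=set0).
  have [||m [_ m0] mP] := @DCC_min _ _ J S dccJ; first exact: subIsetl.
    by exists s.
  by exists m => // r Jr r0; exact: mP.
(* Without positive elements in [J] any positive bound works. *)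
by exists 1 => // r Jr r0; exfalso; apply: S0; exists r.
Qed.

(** * Limits along an ultrafilter on the natural numbers *)

Section Ultrafilter.
Variables (R : realType) (F : set_system nat).
Hypothesis UF : UltraFilter F.

(** Only finitely many naturals are at most [x]; if no fibre of [v] belonged to [F], the finitely
    many complements would meet in a set of [F]. *)
Lemma ultra_const (v : nat -> nat) (x : R) :
  (\forall n \near F, (v n)%:R <= x) -> exists c, \forall n \near F, v n = c.
Proof.
move=> vx; have PF : ProperFilter F := ultra_proper; apply: contrapT => nc.
have : \forall n \near F, forall c : 'I_(Num.truncn x).+1, v n <> c.
  apply: filter_forall => c.
  by have [Fc|//] := in_ultra_setVsetC [set n | v n = c] UF; case: nc; exists c.
move=> vnc; have /filter_ex[n [vnx {}vnc]] : \forall n \near F, (v n)%:R <= x /\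
    forall c : 'I_(Num.truncn x).+1, v n <> c by exact: filterI.
have lt : (v n < (Num.truncn x).+1)%N.
  by rewrite -(ltr_nat R); apply: le_lt_trans vnx _; exact: truncnS_gt.
exact: (vnc (Ordinal lt)).
Qed.

(** Compactness gives the limit. Values beyond it on a set of [F] are impossible: by DCC the
    elements of [J] above [l] have a minimum, which keeps them away from [l]. *)
Lemma ultra_cvg_from_below (J : set R) (v : nat -> R) (a b : R) : DCC J ->
  (\forall n \near F, J (v n)) -> (\forall n \near F, a <= v n <= b) ->
  exists l : R, v @ F --> l /\ \forall n \near F, v n <= l.
Proof.
move=> dccJ vJ vab; have PF : ProperFilter F := ultra_proper.
have : compact `[a, b] by exact: segment_compact.
(* The image of an ultrafilter is an ultrafilter. *)
have UvF : UltraFilter (v @ F).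
  apply: Build_UltraFilter => G PG FG.
  apply/seteqP; split=> // A GA; rewrite /= /nbhs /=.
  have [//|nA] := in_ultra_setVsetC (v @^-1` A) UF.
  have /filter_ex[y [/= ]] : G (A `&` ~` A) by apply: filterI => //; exact: FG.
  by [].
rewrite compact_ultra => /(_ _ UvF)[|l [_ vl]].
  by rewrite /= /nbhs /=; apply: filterS vab => n; rewrite /= in_itv.
exists l; split=> //.
have [//|Fgt] := in_ultra_setVsetC [set n | v n <= l] UF.
pose S := J `&` [set r | l < r].
have FS : \forall n \near F, S (v n).
  by apply: filterS2 vJ Fgt => n Jn /= /negP; rewrite -ltNge.
have [||m [_ lm] mP] := @DCC_min _ _ J S dccJ; first exact: subIsetl.
  by have /filter_ex[n Sn] := FS; exists (v n).
have vm : \forall n \near F, v n < m by exact: cvgr_lt vl _ lm.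
have /filter_ex[n [/mP mn]] : \forall n \near F, S (v n) /\ v n < m by exact: filterI.
by rewrite ltNge mn.
Qed.

End Ultrafilter.

(** * Log discrepancies over a point and their dependence on the exponents *)

Section MinimalLogDiscrepancies.
Variables (R : realType) (k : closedFieldType) (K : fieldType).
Variables (i : {rmorphism k -> K}) (d : canonical_datum K).
Variables (X : set (set K)) (x : set K).
Implicit Types (E : set K) (a : R_ideal R K) (J : set R).

(** Log discrepancies depend on the ambient variety only through the center, which is [x] on both
    [U] and [X]. *)
Lemma log_canonical_around_log_disc a E : variety i X ->
  log_canonical_around i d X a x ->
  divisor_over i X E -> Defs.center X E = x -> 0 <= log_disc d X a E.
Proof.
move=> vX [U [oU Ux lcU]] dE cE.
have [dUE cUE] := divisor_over_open vX oU Ux dE cE.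
suff <- : log_disc d U a E = log_disc d X a E by exact: lcU.
rewrite /log_disc /k_disc /ord_R_ideal cUE cE; congr (_ - _).
by apply: eq_bigr => j _; rewrite /ord_ideal cUE cE.
Qed.

(* Factors that are trivial at x, or have exponent 0, do not contribute to the
   orders; each of the others contributes at least e to the order along E0. *)
Lemma drop_trivial_factors J (e : R) a E0 : variety i X -> (forall r, J r -> 0 <= r) ->
  0 < e -> (forall r, J r -> 0 < r -> e <= r) ->
  divisor_over i X E0 -> Defs.center X E0 = x ->
  R_ideal_on i X a -> exponents_in J a ->
  0 <= log_disc d X a E0 ->
  exists r (f : 'I_r -> set K -> set K) (lam : 'I_r -> R),
  [/\ r%:R * e <= ratr (k_disc d X E0) + 1,
      forall j, coherent_ideal i X (f j) /\ nonzero_ideal X (f j),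
      forall j, J (lam j) /\ e <= lam j <= ratr (k_disc d X E0) + 1 &
      forall E, divisor_over i X E -> Defs.center X E = x ->
        ord_R_ideal X E (RIdeal f lam) = ord_R_ideal X E a].
Proof.
move=> vX J0 e0 eJ dE0 cE0 aX aJ; rewrite /log_disc subr_ge0.
set M := _ + 1 => ordM.
(* Triviality at [x] is tested by the order along [E0]; by [ord_ideal_eq0] the test has the same
   outcome for every divisor with center [x]. *)
pose P : pred 'I_(nfactors a) :=
  fun j => (0 < exponent a j) && (0 < ord_ideal X E0 (Defs.factor a j))%N.
pose f (t : 'I_#|P|) := Defs.factor a (enum_val t).
pose lam (t : 'I_#|P|) := exponent a (enum_val t).
have Pt (t : 'I_#|P|) : P (enum_val t) := enum_valP t.
have ordE E : divisor_over i X E -> Defs.center X E = x ->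
    ord_R_ideal X E (RIdeal f lam) = ord_R_ideal X E a.
  move=> dE cE; rewrite /ord_R_ideal /=.
  rewrite -(big_enum_val (fun j => exponent a j * (ord_ideal X E (Defs.factor a j))%:R)).
  rewrite big_mkcond /=; apply: eq_bigr => j _; case: ifPn => //.
  rewrite unfold_in negb_and -leqNgt leqn0 => /orP[|/eqP o0].
    have [_ _ aj0] := aX j.
    by rewrite lt0r aj0 andbT negbK => /eqP ->; rewrite mul0r.
  have [cj nj _] := aX j.
  by rewrite (ord_ideal_eq0 vX dE0 dE _ cj nj o0) ?mulr0 // cE.
rewrite -(ordE _ dE0 cE0) /ord_R_ideal /= in ordM.
(* A retained factor has integral order at least 1 along [E0], so [ordM] bounds each exponent and,
   through [e], their number. *)
have term t : lam t <= lam t * (ord_ideal X E0 (f t))%:R.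
  have /andP[l0 o0] := Pt t; by rewrite ler_peMr ?(ltW l0) // ler1n.
have lam_e t : J (lam t) /\ e <= lam t.
  by have /andP[l0 _] := Pt t; split; [exact: aJ|exact: eJ (aJ _) l0].
exists #|P|, f, lam; split=> //.
- apply: le_trans ordM; rewrite mulrC mulr_natr -[X in _ *+ X]card_ord -sumr_const.
  by apply: ler_sum => t _; apply: le_trans (term t); case: (lam_e t).
- by move=> t; have [] := aX (enum_val t).
- move=> t; have [Jt et] := lam_e t; split=> //; rewrite et /=.
  apply: le_trans (term t) _; apply: le_trans ordM; rewrite (bigD1 t) //= lerDl.
  apply: sumr_ge0 => s _; apply: mulr_ge0 => //; apply: le_trans (proj2 (lam_e s)).
  exact: ltW.
Qed.

(** The index clears the denominator and klt gives positivity. Bounded discrepancies therefore take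
    finitely many values. *)
Lemma k_disc_nat E : klt i d X -> divisor_over i X E ->
  exists v : nat, k_disc d X E + 1 = v%:R / (cartier_index d)%:R.
Proof.
move=> [_ _ [_ m0 _] kX] dE; have := kX _ dE.
set m := cartier_index d in m0 *.
pose z : int := (ord_form d E + 1) * m%:Z - ord E (local_equation d (Defs.center X E)).
have mN0 : m%:R != 0 :> rat by rewrite pnatr_eq0 -lt0n.
have -> : k_disc d X E + 1 = z%:~R / m%:R.
  rewrite /z rmorphB rmorphM rmorphD /= mulrBl mulfK // addrAC; congr (_ - _).
rewrite ltr_pdivlMr ?ltr0n // mul0r ltr0z => z0.
exists `|z|%N; last by rewrite natr_absz gtr0_norm.
Qed.

(** Raising exponents raises every order and lowers every log discrepancy. *)
Lemma le_mld (r : nat) (f : 'I_r -> set K -> set K) (lam mu : 'I_r -> R) :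
  (forall j, lam j <= mu j) ->
  (mld i d X (RIdeal f mu) x <= mld i d X (RIdeal f lam) x)%E.
Proof.
move=> lemu; apply: le_ereal_inf_tmp => _ [E [dE cE] <-].
apply: le_trans (ereal_inf_lbound _) _; first by exists E.
rewrite lee_fin lerD2l lerN2; apply: ler_sum => j _; exact: ler_wpM2r.
Qed.

Lemma eq_mld a a' : (forall E, divisor_over i X E -> Defs.center X E = x ->
    ord_R_ideal X E a = ord_R_ideal X E a') ->
  mld i d X a x = mld i d X a' x.
Proof.
move=> aa'; rewrite /mld; congr ereal_inf; apply/seteqP.
by split=> _ [E [dE cE] <-]; exists E => //; rewrite /log_disc aa'.
Qed.

End MinimalLogDiscrepancies.

(** * The ascending chain condition for minimal log discrepancies *)

Theorem theorem1p5 (R : realType) (k : closedFieldType)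
    (char_k : [pchar k] =i pred0) (K : fieldType) (i : {rmorphism k -> K})
    (X : set (set K)) (d : canonical_datum K) (x : set K) :
  klt i d X -> closed_point X x ->
  (forall I : set R, finite_set I -> (forall r, I r -> 0 <= r) ->
     exists2 l : nat, (0 < l)%N &
       forall a : R_ideal R K, R_ideal_on i X a -> exponents_in I a ->
         exists2 E : set K, computes_mld i d X a x E & k_disc d X E <= l%:R) ->
  forall J : set R, (forall r, J r -> 0 <= r) -> DCC J ->
    ACC [set mld i d X a x | a in
           [set a : R_ideal R K | [/\ R_ideal_on i X a, exponents_in J a &
                                      log_canonical_around i d X a x]]].
Proof.
move=> kltX _ bdd J J0 dccJ [u hu]; have [vX _ _ _] := kltX.
(* The hypothesis for the empty set of exponents, applied to the empty product, provides a divisor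
   with center [x]. *)
have [E0 dE0 cE0] : exists2 E0, divisor_over i X E0 & Defs.center X E0 = x.
  have [|//|l _ hl] := bdd set0; first exact: finite_set0.
  have [||E0 [dE0 cE0 _ _] _] := hl (@RIdeal R K 0 (fun _ _ => set0) (fun _ => 0)).
  - by case.
  - by case.
  - by exists E0.
have [e e0 eJ] := DCC_pos_lbound dccJ.
pose M : R := ratr (k_disc d X E0) + 1.
pose good r (f : 'I_r -> set K -> set K) (lam : 'I_r -> R) n :=
  [/\ forall j, coherent_ideal i X (f j) /\ nonzero_ideal X (f j),
      forall j, J (lam j) /\ e <= lam j <= M,
      forall E, divisor_over i X E -> Defs.center X E = x ->
        0 <= log_disc d X (RIdeal f lam) E &
      mld i d X (RIdeal f lam) x = u n].
have /choice[r_ r_P] n : exists r, r%:R * e <= M /\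
    exists f lam, @good r f lam n.
  have [[a [aX aJ lca] au] _] := hu n.
  have lc E := log_canonical_around_log_disc vX lca (E := E).
  have [r [f [lam [rM fP lamP ordE]]]] :=
    drop_trivial_factors vX J0 e0 eJ dE0 cE0 aX aJ (lc _ dE0 cE0).
  exists r; split=> //; exists f, lam; split=> //.
  - by move=> E dE cE; rewrite /log_disc ordE //; exact: lc.
  - by rewrite -au; exact: eq_mld.
(* [F] refines the filter of cofinite sets, so each property below holding [F]-almost everywhere
   holds at arbitrarily large indices. *)
have [F [UF Foo]] := @ultraFilterLemma nat (nbhs \oo) _.
have PF : ProperFilter F := ultra_proper.
have [r Fr] : exists r, \forall n \near F, r_ n = r.
  apply: (ultra_const UF (x := M / e)); apply: filterE => n.
  by rewrite ler_pdivlMr //; case: (r_P n).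
have /choice[fl flP] n : exists fl : ('I_r -> set K -> set K) * ('I_r -> R),
    r_ n = r -> good r fl.1 fl.2 n.
  (* Indices with another number of factors receive dummy data, which [F] ignores. *)
  have [rn|nrn] := pselect (r_ n = r); last by exists (fun _ _ => set0, fun _ => 0).
  by case: (r_P n) => _; rewrite rn => -[f [lam fl]]; exists (f, lam).
have /choice[l lP] j : exists l : R, (fl n).2 j @[n --> F] --> l /\
    \forall n \near F, (fl n).2 j <= l.
  apply: (ultra_cvg_from_below UF (a := e) (b := M) dccJ).
  - by apply: filterS Fr => n /flP[_ /(_ j)[]].
  - by apply: filterS Fr => n /flP[_ /(_ j)[]].
have lge : \forall n \near F, forall j, (fl n).2 j <= l j.
  by apply: filter_forall => j; case: (lP j).
have l0 j : 0 <= l j.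
  have /filter_ex[n [/flP[_ /(_ j)[_ /andP[el _]] _ _] ll]] :
    \forall n \near F, r_ n = r /\ forall j, (fl n).2 j <= l j by exact: filterI.
  by apply: le_trans (ll j); apply: le_trans el; exact: ltW.
have [||ell _ ellP] := bdd (range l).
- by apply: finite_image; exact: finite_finset.
- by move=> _ [j _ <-].
have /choice[E EP] n : exists E, r_ n = r ->
    computes_mld i d X (RIdeal (fl n).1 l) x E /\ k_disc d X E <= ell%:R.
  have [rn|nrn] := pselect (r_ n = r); last by exists set0.
  have [fP _ _ _] := flP n rn.
  have [||E cE kE] := ellP (RIdeal (fl n).1 l); last by exists E.
    by move=> j; have [] := fP j.
  by move=> j; exists j.
pose m := cartier_index d.
have /choice[kap kapP] n : exists v : nat, r_ n = r ->
    k_disc d X (E n) + 1 = v%:R / m%:R.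
  have [/EP[[dE _ _ _] _]|nrn] := pselect (r_ n = r); last by exists 0%N.
  by have [v kv] := k_disc_nat kltX dE; exists v.
have kapR n : r_ n = r -> ratr (k_disc d X (E n)) + 1 = (kap n)%:R / m%:R :> R.
  by move=> /kapP/(congr1 (@ratr R)); rewrite rmorphD rmorph1 fmorph_div /= !ratr_nat.
have kap_le n : r_ n = r -> (kap n)%:R / m%:R <= ell.+1%:R :> R.
  move=> rn; rewrite -kapR // -[ell.+1]addn1 natrD lerD2r -(ratr_nat R) ler_rat.
  by case: (EP n rn).
have [kp Fkp] : exists c, \forall n \near F, kap n = c.
  apply: (ultra_const UF (x := ell.+1%:R * m%:R : R)); apply: filterS Fr => n rn.
  have [_ _ [_ m0 _] _] := kltX.
  by rewrite /= -ler_pdivrMr ?ltr0n ?kap_le.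
pose A n := log_disc d X (RIdeal (fl n).1 (fl n).2) (E n).
have A_ge0 n : r_ n = r -> 0 <= A n.
  by move=> rn; have [_ _ lcf _] := flP n rn; apply: lcf; case: (EP n rn) => -[].
(* Nonnegativity of [A n] bounds the whole order along [E n] by [ell.+1]; since each exponent is at
   least [e], each factor has order at most [ell.+1 / e]. *)
have /choice[oj Fo] j : exists c, \forall n \near F,
    ord_ideal X (E n) ((fl n).1 j) = c.
  apply: (ultra_const UF (x := ell.+1%:R / e : R)); apply: filterS Fr => n rn.
  rewrite ler_pdivlMr //; apply: le_trans (kap_le n rn).
  have := A_ge0 n rn; rewrite /A /log_disc kapR // subr_ge0; apply: le_trans.
  have [_ lamP _ _] := flP n rn.
  have lam_e s : e <= (fl n).2 s by case: (lamP s) => _ /andP[].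
  rewrite /ord_R_ideal /= (bigD1 j) //= mulrC -[leLHS]addr0; apply: lerD.
    exact: ler_wpM2r.
  apply: sumr_ge0 => s _; apply: mulr_ge0 => //; apply: le_trans (lam_e s).
  exact: ltW.
(* For [F]-most n, [c] and [A' n] are the log discrepancies along [E n] with the limit exponents and
   with the original ones. *)
pose c : R := kp%:R / m%:R - \sum_j l j * (oj j)%:R.
pose A' n := kp%:R / m%:R - \sum_j (fl n).2 j * (oj j)%:R.
have A'c : A' n @[n --> F] --> c.
  apply: cvgB; first exact: cvg_cst.
  apply: cvg_big => [|j _]; first exact: add_continuous.
  by apply: cvgMl; case: (lP j).
have Foj : \forall n \near F, forall j, ord_ideal X (E n) ((fl n).1 j) = oj j.
  exact: filter_forall.
have FP : \forall n \near F, [/\ 0 <= A' n, (u n <= (A' n)%:E)%E &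
    0 <= c -> (c%:E <= u n)%E].
  near=> n.
  have rn : r_ n = r by near: n.
  have on : forall j, ord_ideal X (E n) ((fl n).1 j) = oj j by near: n.
  have [[dE cE pos neg] kE] := EP n rn; have [fP lamP lcf mldf] := flP n rn.
  have AA' : A n = A' n.
    rewrite /A /log_disc kapR // (near Fkp n) //; congr (_ - _).
    by apply: eq_bigr => j _; rewrite on.
  have AC : log_disc d X (RIdeal (fl n).1 l) (E n) = c.
    rewrite /log_disc kapR // (near Fkp n) //; congr (_ - _).
    by apply: eq_bigr => j _; rewrite on.
  rewrite -AA'; split; first exact: A_ge0.
  - by rewrite -mldf; apply: ereal_inf_lbound; exists (E n).
  (* A negative minimal log discrepancy would make its computing divisor have log discrepancy
     [c < 0], so [E n] attains the infimum. *)
  - move=> c0; have -> : c%:E = mld i d X (RIdeal (fl n).1 l) x.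
      rewrite -AC; apply: pos; rewrite leNgt; apply/negP => /neg.
      by rewrite AC ltNge c0.
    by rewrite -mldf; apply: le_mld; near: n.
have c0 : 0 <= c.
  rewrite leNgt; apply/negP => c0.
  have A'0 : \forall n \near F, A' n < 0 by exact: cvgr_lt A'c _ c0.
  have /filter_ex[n []] : \forall n \near F, 0 <= A' n /\ A' n < 0.
    by apply: filterS2 FP A'0 => n [].
  by move=> A'n; rewrite ltNge A'n.
have [n0 [_ _ /(_ c0) cu0]] : exists n0, [/\ 0 <= A' n0,
    (u n0 <= (A' n0)%:E)%E & 0 <= c -> (c%:E <= u n0)%E] by exact: filter_ex FP.
(* One strict increase past [n0] leaves a gap above [c] that all later [u n] respect. *)
have cu1 : (c%:E < u n0.+1)%E by apply: le_lt_trans cu0 _; case: (hu n0).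
have [w [cw wu]] : exists w : R, c < w /\ (w%:E <= u n0.+1)%E.
  case: (u n0.+1) cu1 => [w|_|//]; first by rewrite lte_fin; exists w.
  (* This is the case where [u n0.+1] is infinite. *)
  by exists (c + 1); rewrite ltrDl ltr01 leey.
have A'w : \forall n \near F, A' n < w by exact: cvgr_lt A'c _ cw.
have /filter_ex[n [[_ uA' _] /= [A'wn n0n]]] : \forall n \near F, [/\ 0 <= A' n,
    (u n <= (A' n)%:E)%E & 0 <= c -> (c%:E <= u n)%E] /\
    (A' n < w /\ (n0 < n)%N).
  apply: filterI FP _; apply: filterI A'w _; apply: Foo; exact: nbhs_infty_gt.
have un : (u n0.+1 <= u n)%E.
  apply: (homo_leq (@lexx _ _) (@le_trans _ _)) n0n => p.
  by apply: ltW; case: (hu p).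
have : (w%:E <= (A' n)%:E)%E by exact: le_trans (le_trans wu un) uA'.
by rewrite lee_fin leNgt A'wn.
Unshelve. all: by end_near.
Qed.
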